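(* Let $1\le p<q\le n$ and let $0<r_q<q$. The following exchange laws, which transform $\tau_q^{r_q}\cdot\tau_p^{r_p}$ into the generalized standard $OGS$ presentation, hold in $B_n$. (1) If $0<r_p<p$: $$\tau_q^{r_q}\cdot\tau_p^{r_p}=\begin{cases}\tau_{r_q}^{-r_q}\cdot\tau_{r_q+r_p}^{r_q}\cdot\tau_{p+r_q}^{r_p}\cdot\tau_q^{r_q} & \text{if } q-r_q\ge p,\\[2pt] \tau_{r_q}^{p-q}\cdot\tau_{r_q+r_p}^{q-p}\cdot\tau_q^{r_q+r_p} & \text{if } r_p\le q-r_q\le p,\\[2pt] \tau_{p+r_q-q}^{r_q+r_p-q}\cdot\tau_{r_q}^{p-r_p-r_q}\cdot\tau_q^{r_q+r_p-p-q} & \text{if } q-r_q\le r_p.\end{cases}$$ (2) If $r_p=-p$: $$\tau_q^{r_q}\cdot\tau_p^{r_p}=\begin{cases}\tau_{r_q}^{-r_q}\cdot\tau_{p+r_q}^{-p-r_q}\cdot\tau_q^{r_q} & \text{if } q-r_q\ge p,\\[2pt] \tau_{p+r_q-q}^{-p-r_q+q}\cdot\tau_{r_q}^{-r_q}\cdot\tau_q^{r_q-q} & \text{if } q-r_q<p.\end{cases}$$ (3) If $-p<r_p<0$: $$\tau_q^{r_q}\cdot\tau_p^{r_p}=\begin{cases}\tau_{r_q+r_p+p}^{r_q}\cdot\tau_{p+r_q}^{r_p-r_q}\cdot\tau_q^{r_q} & \text{if } q-r_q\ge p,\\[2pt] \tau_{p+r_q-q}^{-p-r_q+q}\cdot\tau_{r_q}^{p+r_q-q}\cdot\tau_{r_q+r_p+p}^{q-p}\cdot\tau_q^{p+r_p-q+r_q}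 & \text{if } r_p+p\le q-r_q\le p,\\[2pt] \tau_{p+r_q-q}^{r_p}\cdot\tau_{r_q}^{-r_p}\cdot\tau_q^{r_q+r_p} & \text{if } q-r_q\le r_p+p.\end{cases}$$
   Context: $B_n$ is the group of signed permutations, i.e. the bijections $\pi$ of $\{\pm1,\dots,\pm n\}$ with $\pi(-i)=-\pi(i)$. It is a Coxeter group with generators $s_0,\dots,s_{n-1}$, where $s_0$ exchanges $1$ and $-1$, and for $1\le i\le n-1$, $s_i$ exchanges $i$ with $i+1$ and $-i$ with $-(i+1)$. Products are read from left to right: $(\pi_1\cdot\pi_2)(i)=\pi_2(\pi_1(i))$. For $1\le k\le n$, $\tau_k=s_0s_1\cdots s_{k-1}$ (an element of order $2k$). The generalized standard $OGS$ presentation of an element of $B_n$ is its unique presentation $\tau_1^{i_1}\cdots\tau_n^{i_n}$ with integers $-k\le i_k<k$ (adjacent powers of the same generator are merged and exponents of $\tau_k$ are read modulo $2k$). A factor with subscript $0$ and exponent $0$ is understood as the identity. *)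

(* Defs.v *)
From HB Require Import structures.
From mathcomp Require Import all_boot all_order all_algebra all_fingroup.

Set Implicit Arguments.
Unset Strict Implicit.
Unset Printing Implicit Defensive.

Import Order.TTheory GRing.Theory Num.Theory.
Local Open Scope ring_scope.

(* The set {1,-1,...,n,-n}: the pair (j, b) stands for (-1)^b * (j + 1). *)
Definition letter (n : nat) : finType := ('I_n * bool)%type.

Definition oppl (n : nat) (x : letter n) : letter n := (x.1, ~~ x.2).

(* The product of {perm _} is the left-to-right one: (s * t) x = t (s x). *)
Definition signed_perms (n : nat) : {set {perm letter n}} :=
  [set s : {perm letter n} | [forall x, s (oppl x) == oppl (s x)]].

Lemma signed_perms_group_set (n : nat) : group_set (signed_perms n).
Proof.
apply/group_setP; split=> [|s t]; first by rewrite inE; apply/forallP=> x; rewrite !perm1.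
rewrite !inE => /forallP hs /forallP ht; apply/forallP=> x.
by rewrite !permM (eqP (hs x)) (eqP (ht _)).
Qed.

Definition Bn (n : nat) : {group {perm letter n}} :=
  group (signed_perms_group_set n).

(* Junk value: sgen n i is the identity when i >= n. *)
Definition sgen (n i : nat) : {perm letter n} :=
  match i with
  | 0 => if insub 0%N is Some j then tperm (j, false) (j, true) else 1%g
  | h.+1 =>
    if (insub h, insub h.+1) is (Some j, Some k)
    then (tperm (j, false) (k, false) * tperm (j, true) (k, true))%g else 1%g
  end.

(* tau n 0 = 1, so that a factor of subscript 0 is the identity. *)
Definition tau (n k : nat) : {perm letter n} := (\prod_(0 <= i < k) sgen n i)%g.

Lemma sgen_Bn (n i : nat) : sgen n i \in Bn n.
Proof.
case: i => [|h]; rewrite /sgen.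
  case: insubP => [j _ _|_]; last exact: group1.
  rewrite inE; apply/forallP=> -[x b]; rewrite /oppl !permE /= !xpair_eqE /=.
  by have [->|_] := eqVneq x j; case: b.
case: insubP => [j _ jE|_]; last exact: group1.
case: insubP => [k _ kE|_]; last exact: group1.
have njk : (j == k) = false by rewrite -val_eqE /= jE kE ltn_eqF.
rewrite inE; apply/forallP=> -[x b]; rewrite /oppl !permM /= !permE /=.
have nkj : (k == j) = false by rewrite eq_sym.
have [->|xj] := eqVneq x j; last have [->|xk] := eqVneq x k; case: b;
  by do 6 rewrite /= ?permE /= ?xpair_eqE ?eqxx ?njk ?nkj ?(negPf xj) ?(negPf xk) ?andbF.
Qed.

Lemma tau_Bn (n k : nat) : tau n k \in Bn n.
Proof. by apply: group_prod => i _; exact: sgen_Bn. Qed.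

Definition expgz (gT : finGroupType) (x : gT) (m : int) : gT :=
  match m with
  | Posz e => (x ^+ e)%g
  | Negz e => (x ^- e.+1)%g
  end.

Definition ogs_presentation (n : nat) (g : {perm letter n}) (i : nat -> int) : Prop :=
  [/\ g \in Bn n,
      forall k : nat, (1 <= k <= n)%N -> - k%:Z <= i k < k%:Z
    & g = (\prod_(1 <= k < n.+1) expgz (tau n k) (i k))%g].

(* A word [:: (k_1, e_1); ...; (k_m, e_m)] stands for
   tau_{k_1}^{e_1} ... tau_{k_m}^{e_m}. The absolute value only serves to turn
   the subscript into a natural number; ordered_word requires it to be
   nonnegative. *)
Definition word_val (n : nat) (w : seq (int * int)) : {perm letter n} :=
  (\prod_(f <- w) expgz (tau n `|f.1|%N) f.2)%g.

(* Equal subscripts are allowed, as adjacent powers of the same generator get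
   merged. *)
Definition ordered_word (n : nat) (w : seq (int * int)) : bool :=
  all (fun f => (0 <= f.1 <= n%:Z) && ((f.1 == 0) ==> (f.2 == 0))) w
  && sorted <=%R [seq f.1 | f <- w].

(* The representative of e modulo 2k in [-k, k). *)
Definition centered (k : nat) (e : int) : int :=
  ((e + k%:Z) %% (2 * k%:Z))%Z - k%:Z.

Definition collected_exponent (w : seq (int * int)) (k : nat) : int :=
  centered k (\sum_(f <- w | f.1 == k%:Z) f.2).

(* g equals w, and w is the generalized standard OGS presentation of g once
   adjacent powers of the same generator are merged and the exponents of tau_k
   are read modulo 2k. *)
Definition has_ogs_word (n : nat) (g : {perm letter n}) (w : seq (int * int)) : Prop :=
  [/\ g = word_val n w,
      ordered_word n w
    & ogs_presentation g (collected_exponent w)].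

(* Main.v *)
(* On the letters 1, ..., k, -1, ..., -k, in this cyclic order, tau_k is the
   backward shift; it fixes the other letters. So tau_k^(2k) = 1, and a power
   tau_k^e with |e| <= k acts by a piecewise linear formula with four pieces.
   All exponents of the exchange laws satisfy this bound, hence each law is an
   identity between compositions of piecewise linear maps, which a case analysis
   reduces to linear arithmetic. *)
Require Import Defs.
From mathcomp Require Import all_boot all_order all_algebra all_fingroup.
From mathcomp Require Import zify.
Import Order.TTheory GRing.Theory Num.Theory.
Local Open Scope ring_scope.

(** * Integer powers in a finite group *)

Lemma expgzS (gT : finGroupType) (x : gT) (m : int) :
  expgz x (m + 1) = (expgz x m * x)%g.
Proof.
case: m => [e|e].
  by rewrite (_ : Posz e + 1 = Posz e.+1) /= ?expgSr //; lia.
case: e => [|e]; first by rewrite /= expg1 mulVg.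
rewrite (_ : Negz e.+1 + 1 = Negz e) /=; last by lia.
by rewrite [(x ^+ e.+2)%g]expgS invMg mulgKV.
Qed.

Lemma expgzD (gT : finGroupType) (x : gT) (a b : int) :
  expgz x (a + b) = (expgz x a * expgz x b)%g.
Proof.
elim/int_rec: b => [|b IHb|b IHb].
- by rewrite addr0 mulg1.
- by rewrite -[Posz b.+1]/(Posz (1 + b)) PoszD [1 + _]addrC addrA !expgzS IHb mulgA.
(* Multiplying by [x] on the right raises the negative exponent by one, back to the induction
   hypothesis. *)
- apply: (mulIg x); rewrite -mulgA -!expgzS.
  by rewrite -addrA (_ : - Posz b.+1 + 1 = - Posz b) ?IHb //; lia.
Qed.

Lemma expgzX (gT : finGroupType) (x : gT) (m : nat) (z : int) :
  (x ^+ m = 1)%g -> expgz x (z * m%:Z) = 1%g.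
Proof.
case: z => e xm; first by rewrite -PoszM /= mulnC expgM xm expg1n.
rewrite NegzE mulNr -PoszM.
apply: (mulIg (expgz x (Posz (e.+1 * m)))).
by rewrite -expgzD addNr mul1g /= mulnC expgM xm expg1n.
Qed.

Lemma expgz_in (gT : finGroupType) (G : {group gT}) (x : gT) (m : int) :
  x \in G -> expgz x m \in G.
Proof. by case: m => e Gx /=; rewrite ?groupV groupX. Qed.

(** * Action of the powers of [tau] on the letters *)

(** Forgetting the bound of the ordinal turns positions into integers, which [lia] can handle. *)
Definition lval {n : nat} (x : letter n) : int * bool := ((x.1 : nat)%:Z, x.2).

Lemma lval_inj {n : nat} : injective (@lval n).
Proof. by case=> [i b] [j c] [/val_inj -> ->]. Qed.

(* tau_k cycles the letters k -> ... -> 1 -> -k -> ... -> -1 -> k; turn k e is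
   the e-th power of this cycle, for |e| <= k only. *)
Definition turn (k e : int) (v : int * bool) : int * bool :=
  if v.1 < k then
    if v.1 - e < 0 then (v.1 - e + k, ~~ v.2)
    else if v.1 - e < k then (v.1 - e, v.2) else (v.1 - e - k, ~~ v.2)
  else v.

Lemma lval_sgenS (n h : nat) (x : letter n) : (h.+1 < n)%N ->
  lval (sgen n h.+1 x) =
    if lval x == (h%:Z, x.2) then (h.+1%:Z, x.2)
    else if lval x == (h.+1%:Z, x.2) then (h%:Z, x.2) else lval x.
Proof.
move=> hn; rewrite /sgen.
case: insubP => [j _ jE|]; last by lia.
case: insubP => [k _ kE|]; last by lia.
case: x => i b; rewrite permM /= /lval /= !xpair_eqE !eqxx !andbT -kE -jE !eqz_nat.
have njk : (j == k) = false by rewrite -val_eqE /= jE kE ltn_eqF.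
have nkj : (k == j) = false by rewrite eq_sym.
rewrite !(inj_eq val_inj).
have [->|xj] := eqVneq i j; last have [->|xk] := eqVneq i k; case: b;
  by do 6 rewrite /= ?permE /= ?xpair_eqE ?eqxx ?njk ?nkj ?(negPf xj) ?(negPf xk) ?andbF.
Qed.

Lemma lval_sgen0 (n : nat) (x : letter n) : (0 < n)%N ->
  lval (sgen n 0 x) = turn 1 1 (lval x).
Proof.
move=> n0; rewrite /sgen; case: insubP => [j _ jE|]; last by lia.
case: x => i b; rewrite permE /= !xpair_eqE -val_eqE /= jE /turn /lval /=.
case: ltP => i0; case: eqP => //= i1; try lia.
by case: b; rewrite /= jE ifT ?i1.
Qed.

(** Products act from left to right, so passing from [tau n k.+1] to [tau n k.+2] appends the
    exchange of positions [k] and [k.+1]. This inserts position [k.+1] into the cycle, just before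
    [k]. The case of [s_0] is a separate base, being a sign change. *)
Lemma lval_tau (n k : nat) (x : letter n) : (k <= n)%N ->
  lval (tau n k x) = turn k 1 (lval x).
Proof.
elim: k => [|[|k] IHk] kn.
- by rewrite /tau big_geq // perm1.
- by rewrite /tau big_nat1 lval_sgen0.
rewrite /tau big_nat_recr //= permM -/(tau n k.+1) lval_sgenS //.
move: (IHk (ltnW kn)) => {IHk}; case: (tau n k.+1 x) => j c; case: x => i b.
rewrite /lval /turn /= => E.
move: E; do ![case: ifP] => /=; rewrite ?xpair_eqE ?eqxx ?andbT.
all: intros; match goal with H : (_, _) = (_, _) |- _ => case: H => ? -> end.
all: try lia; congr pair; lia.
Qed.

Lemma turnD1 (k : nat) (e : nat) (v : int * bool) : 0 <= v.1 -> (e < k)%N ->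
  turn k e.+1%:Z v = turn k 1 (turn k e v).
Proof.
case: v => j b; rewrite /turn /= => j0 ek.
by do ![case: ifP => /=]; intros; rewrite ?negbK; try lia; congr pair; lia.
Qed.

Lemma turnK (k : int) (e : int) (v : int * bool) : 0 <= v.1 -> - k <= e <= k ->
  turn k e (turn k (- e) v) = v.
Proof.
case: v => j b; rewrite /turn /= => j0 ek.
by do ![case: ifP => /=]; intros; rewrite ?negbK; try lia; congr pair; lia.
Qed.

Lemma lval_tauX (n k e : nat) (x : letter n) : (k <= n)%N -> (e <= k)%N ->
  lval ((tau n k ^+ e)%g x) = turn k e (lval x).
Proof.
move=> kn; elim: e => [|e IHe] ek.
  rewrite expg0 perm1 /turn; case: x => j b; rewrite /lval /=.
  by do ![case: ifP] => //; intros; try lia; congr pair; lia.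
by rewrite expgSr permM lval_tau // IHe 1?ltnW // turnD1.
Qed.

Lemma lval_expgz_tau (n : nat) (k e : int) (x : letter n) :
  0 <= k <= n%:Z -> - k <= e <= k ->
  lval (expgz (tau n `|k|%N) e x) = turn k e (lval x).
Proof.
case: k => // k /andP[_ kn] ek.
case: e ek => e ek; first by rewrite /= lval_tauX //; lia.
(* For a negative exponent, [x] is the image of [y] under a positive power, and [turnK] undoes that
   power. *)
pose y := expgz (tau n k) (Negz e) x; rewrite -/y.
have -> : x = ((tau n k) ^+ e.+1)%g y by rewrite -permM /= mulVg perm1.
rewrite lval_tauX; try lia.
by rewrite NegzE -{2}[Posz e.+1]opprK turnK //; lia.
Qed.

(** [tau_k^k] only changes the sign of the first [k] letters, so its square is trivial. The exponent
    is split as [k + k] because [turn] describes powers only up to [k]. *)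
Lemma tauX_order (n k : nat) : (k <= n)%N -> (tau n k ^+ (2 * k) = 1)%g.
Proof.
move=> kn; apply/permP => x; apply: lval_inj.
rewrite mul2n -addnn expgD permM perm1 !lval_tauX //.
case: x => j b; rewrite /turn /lval /=.
by do ![case: ifP => /=]; intros; rewrite ?negbK; try lia; congr pair; lia.
Qed.

(** * From ordered words to the generalized standard OGS presentation *)

Lemma centered_bound (k : nat) (e : int) : (0 < k)%N ->
  - k%:Z <= centered k e < k%:Z.
Proof.
move=> k0; rewrite /centered.
have := modz_ge0 (e + k%:Z) (_ : 2 * k%:Z != 0).
have := ltz_pmod (e + k%:Z) (_ : 0 < 2 * k%:Z).
by lia.
Qed.

Lemma expgz_tau_centered (n k : nat) (e : int) : (k <= n)%N ->
  expgz (tau n k) (centered k e) = expgz (tau n k) e.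
Proof.
move=> kn; have {2}-> :
    e = centered k e + ((e + k%:Z) %/ (2 * k%:Z))%Z * (2 * k)%N%:Z.
  by rewrite /centered PoszM; have := divz_eq (e + k%:Z) (2 * k%:Z); lia.
by rewrite expgzD expgzX ?mulg1 // tauX_order.
Qed.

(** Induction on the word: the head has the least subscript [k], so in both products the factors
    below [k] are trivial and the head merges into the [k]-th factor. *)
Lemma ordered_word_val (n : nat) (w : seq (int * int)) : ordered_word n w ->
  word_val n w =
    (\prod_(0 <= k < n.+1) expgz (tau n k) (\sum_(f <- w | f.1 == k%:Z) f.2))%g.
Proof.
rewrite /word_val; elim: w => [|[k e] w IHw].
  by rewrite big_nil => _; rewrite big1 // => k _; rewrite big_nil.
rewrite /ordered_word /= => /andP[/andP[/andP[/andP[k0 kn] _] wn] sw].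
have ws : all (fun f => k <= f.1) w.
  by move: sw; rewrite path_sortedE => [/andP[]|]; [rewrite all_map | exact: le_trans].
rewrite big_cons IHw; last by rewrite /ordered_word wn (path_sorted sw).
case: k k0 kn ws {sw} => // k _ /= kn ws.
have kn1 : (k < n.+1)%N by lia.
rewrite !(big_cat_nat (m := 0%N) (n := k) (p := n.+1)) //=; try lia.
rewrite !(big_ltn kn1) !mulgA.
have E0 (i : nat) : (i < k)%N -> \sum_(f <- w | f.1 == i%:Z) f.2 = 0.
  move=> ik; rewrite big_seq_cond big1 // => f /andP[/(allP ws) /= kf /eqP fi]; lia.
have -> : (\prod_(0 <= i < k) expgz (tau n i) (\sum_(f <- w | f.1 == i%:Z) f.2) = 1)%g.
  by rewrite big_nat big1 // => i /andP[_ ik]; rewrite E0.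
have -> : (\prod_(0 <= i < k)
    expgz (tau n i) (\sum_(f <- (k%:Z, e) :: w | f.1 == i%:Z) f.2) = 1)%g.
  rewrite big_nat big1 // => i /andP[_ ik]; rewrite big_cons E0 //=.
  by rewrite ifF //; lia.
rewrite mulg1 mul1g big_cons /= eqxx expgzD; congr (_ * _)%g.
rewrite big_nat [RHS]big_nat; apply: eq_bigr => i /andP[ki _].
by rewrite big_cons /= ifF //; lia.
Qed.

Lemma has_ogs_wordP (n : nat) (g : {perm letter n}) (w : seq (int * int)) :
  g = word_val n w -> ordered_word n w -> has_ogs_word g w.
Proof.
move=> gE ow; split=> //; split.
- by rewrite gE; apply: group_prod => f _; apply: expgz_in; exact: tau_Bn.
- by move=> k /andP[k0 _]; exact: centered_bound.
(* The presentation starts at subscript 1; the extra factor at 0 is a power of the identity. *)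
rewrite gE ordered_word_val // big_ltn // (_ : tau n 0 = 1%g); last first.
  by rewrite /tau big_geq.
have -> z : expgz (1%g : {perm letter n}) z = 1%g.
  by case: z => e /=; rewrite expg1n ?invg1.
rewrite mul1g big_nat [RHS]big_nat; apply: eq_bigr => k /andP[_ kn].
by rewrite /collected_exponent expgz_tau_centered.
Qed.

(** * The exchange laws as identities between piecewise linear maps *)

Variant turn_spec (k e j : int) (b : bool) : int * bool -> Prop :=
  | TurnFix of k <= j : turn_spec k e j b (j, b)
  | TurnIn of j < k & e <= j & j < e + k : turn_spec k e j b (j - e, b)
  | TurnBelow of j < k & j < e : turn_spec k e j b (j - e + k, ~~ b)
  | TurnAbove of j < k & e + k <= j : turn_spec k e j b (j - e - k, ~~ b).

Lemma turnP (k e j : int) (b : bool) : 0 <= k -> turn_spec k e j b (turn k e (j, b)).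
Proof.
rewrite /turn /= => k0.
by do ![case: ifP]; intros; constructor; lia.
Qed.

(** Only a [turn] applied to an explicit pair matches, so compositions are unfolded from the inside
    out. Calling [lia] first prunes contradictory branches before they split further. *)
Ltac turn_cases :=
  first [ lia |
  lazymatch goal with
  | |- context [turn ?k ?e (?j, ?b)] =>
      case: (@turnP k e j b); [lia | move=> *; turn_cases ..]
  | |- _ => rewrite ?negbK; congr pair; lia
  end].

Definition turn_word (w : seq (int * int)) (v : int * bool) : int * bool :=
  foldl (fun u f => turn f.1 f.2 u) v w.

Definition bounded_word (n : nat) (w : seq (int * int)) : bool :=
  all (fun f => (0 <= f.1 <= n%:Z) && (- f.1 <= f.2 <= f.1)) w.

Lemma lval_word_val (n : nat) (w : seq (int * int)) (x : letter n) :
  bounded_word n w -> lval (word_val n w x) = turn_word w (lval x).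
Proof.
rewrite /word_val; elim: w x => [|f w IHw] x /=; first by rewrite big_nil perm1.
case/andP => /andP[kn ek] bw.
by rewrite big_cons permM IHw // lval_expgz_tau.
Qed.

(** A permutation is determined by its action seen through [lval], so equality of words may be
    tested at all nonnegative integers [j], where [n] no longer enters. *)
Lemma has_ogs_word_turn (n : nat) (u w : seq (int * int)) :
  bounded_word n u -> bounded_word n w -> ordered_word n w ->
  (forall j b, 0 <= j -> turn_word u (j, b) = turn_word w (j, b)) ->
  has_ogs_word (word_val n u) w.
Proof.
move=> bu bw ow uw; apply: has_ogs_wordP => //.
by apply/permP => x; apply: lval_inj; rewrite !lval_word_val // uw.
Qed.

Ltac exchange :=
  apply: has_ogs_word_turn;
  [ rewrite /bounded_word /=; lia | rewrite /bounded_word /=; lia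
  | rewrite /ordered_word /=; lia | move=> ? ? ?; rewrite /turn_word /=; turn_cases ].

Theorem proposition2p1p8 (n p q : nat) (rq rp : int) :
  (1 <= p)%N -> (p < q)%N -> (q <= n)%N -> 0 < rq < q%:Z ->
  let P := p%:Z in
  let Q := q%:Z in
  let g := (expgz (tau n q) rq * expgz (tau n p) rp)%g in
  [/\ 0 < rp < P ->
      [/\ P <= Q - rq ->
            has_ogs_word g
              [:: (rq, - rq); (rq + rp, rq); (P + rq, rp); (Q, rq)],
          rp <= Q - rq <= P ->
            has_ogs_word g
              [:: (rq, P - Q); (rq + rp, Q - P); (Q, rq + rp)]
        & Q - rq <= rp ->
            has_ogs_word g
              [:: (P + rq - Q, rq + rp - Q); (rq, P - rp - rq);
                  (Q, rq + rp - P - Q)]],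
      rp = - P ->
      (P <= Q - rq ->
         has_ogs_word g
           [:: (rq, - rq); (P + rq, - P - rq); (Q, rq)])
      /\
      (Q - rq < P ->
         has_ogs_word g
           [:: (P + rq - Q, - P - rq + Q); (rq, - rq); (Q, rq - Q)])
    & - P < rp < 0 ->
      [/\ P <= Q - rq ->
            has_ogs_word g
              [:: (rq + rp + P, rq); (P + rq, rp - rq); (Q, rq)],
          rp + P <= Q - rq <= P ->
            has_ogs_word g
              [:: (P + rq - Q, - P - rq + Q); (rq, P + rq - Q);
                  (rq + rp + P, Q - P); (Q, P + rp - Q + rq)]
        & Q - rq <= rp + P ->
            has_ogs_word g
              [:: (P + rq - Q, rp); (rq, - rp); (Q, rq + rp)]]].
Proof.
move=> p1 pq qn rqq P Q g.
(* The left side becomes a word too, so that both sides are evaluated by [turn_word]. *)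
have -> : g = word_val n [:: (Q, rq); (P, rp)].
  by rewrite /word_val !big_cons big_nil mulg1.
have {p1 pq qn}[P1 PQ Qn] : [/\ 1 <= P, P < Q & Q <= n%:Z] by split; lia.
(* From here [P] and [Q] are arbitrary integers subject to linear constraints. *)
rewrite -/Q in rqq; clear g; clearbody P Q.
split=> [rpp|rpE|rpp]; [split=> h | split=> h | split=> h].
all: exchange.
Qed.
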